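(* Let $h>0$. The set of functions $f\in C^{\nearrow h}$ such that $f\notin C^h(t)$ for every $t\in[0,1]$ is Baire-residual in $C^{\nearrow h}$.
   Context: For $\alpha>0$ non-integer, $C^\alpha([0,1])$ is the usual Hölder space of order $\alpha$ on $[0,1]$ (for integer $\alpha$ it is replaced by the space of functions whose wavelet coefficients $c_{j,k}$ on $[0,1]$ satisfy $\sup_{j}\sup_{0\le k<2^j}2^{\alpha j}|c_{j,k}|<\infty$, which does not affect the intersection below). $C^{\nearrow h}=\bigcap_{\alpha<h}C^\alpha([0,1])$ (intersection over $\alpha\in(0,h)$) is a Fréchet space for the topology generated by the norms of the spaces $C^\alpha([0,1])$, $\alpha<h$. For $t\in[0,1]$, $C^h(t)$ is the set of functions $f$ such that $\limsup_{s\to t}\frac{|f(s)-f(t)|}{|s-t|^h}<+\infty$. A subset of a Baire space $X$ is of first category (meager) if it is included in a countable union of closed sets with empty interior; the complement of a set of first category is called Baire-residual. *)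

(* Defs.v *)
From HB Require Import structures.
From mathcomp Require Import all_boot all_order all_algebra.
From mathcomp Require Import all_classical all_reals all_analysis.

Set Implicit Arguments.
Unset Strict Implicit.
Unset Printing Implicit Defensive.

Import Order.TTheory GRing.Theory Num.Theory.
Import numFieldNormedType.Exports.

Local Open Scope classical_set_scope.
Local Open Scope ring_scope.

Definition first_category (X : topologicalType) (A : set X) : Prop :=
  exists F : nat -> set X,
    (forall n, closed (F n) /\ interior (F n) = set0) /\
    A `<=` \bigcup_n F n.

Definition baire_residual (X : topologicalType) (A : set X) : Prop :=
  first_category (~` A).

(** Real functions on [0, 1]. The interval is a type of its own, with the
    induced topology, so that all limits are taken inside it; in particular
    the derivatives at 0 and 1 are one-sided. *)

Definition unit_itv (R : realType) : set R := [set x | 0 <= x <= 1].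
Notation I01 R := (set_type (@unit_itv R)).

Definition slope (R : realType) (f : I01 R -> R) (t s : I01 R) : R :=
  (f s - f t) / (val s - val t).

Definition D01 (R : realType) (f : I01 R -> R) : I01 R -> R :=
  fun t => lim (slope f t s @[s --> t^']).

Definition D01n (R : realType) (k : nat) (f : I01 R -> R) : I01 R -> R :=
  iter k (@D01 R) f.

Definition derivable01n (R : realType) (m : nat) (f : I01 R -> R) : Prop :=
  forall k : nat, (k < m)%N ->
  forall t : I01 R, cvg (slope (D01n k f) t s @[s --> t^']).

(** The notions below are meant for a non-integer order a > 0: the finiteness of
    the seminorm of exponent a - m > 0 then makes the m-th derivative continuous. *)

Definition unif_norm (R : realType) (f : I01 R -> R) : \bar R :=
  ereal_sup [set (`|f t|)%:E | t in [set: I01 R]].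

Definition holder_seminorm (R : realType) (b : R) (f : I01 R -> R) : \bar R :=
  ereal_sup [set (`|f p.1 - f p.2| / `|val p.1 - val p.2| `^ b)%:E
            | p in [set p : I01 R * I01 R | p.1 != p.2]].

Definition holder_norm (R : realType) (a : R) (f : I01 R -> R) : \bar R :=
  let m := Num.truncn a in
  ((\sum_(0 <= k < m.+1) unif_norm (D01n k f))
   + holder_seminorm (a - m%:R)%R (D01n m f))%E.

(* Differentiability is required separately: [D01] is a junk value where the
   limit of the slopes does not exist. *)
Definition holder (R : realType) (a : R) : set (I01 R -> R) :=
  [set f | derivable01n (Num.truncn a) f /\ (holder_norm a f < +oo)%E].

(** Integer orders are omitted: the spaces that wavelet coefficients define
    for them lie between Hölder spaces of non-integer order, so they change
    neither the intersection nor its topology. *)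

Definition orders_below (R : realType) (h : R) : set R :=
  [set a | 0 < a < h /\ a \isn't a Num.int].

Definition holder_below_set (R : realType) (h : R) : set (I01 R -> R) :=
  \bigcap_(a in orders_below h) holder a.

Record holder_below (R : realType) (h : R) := HolderBelow {
  holder_below_fun :> I01 R -> R ;
  holder_belowP : holder_below_set h holder_below_fun }.

HB.instance Definition _ (R : realType) (h : R) :=
  gen_eqMixin (holder_below h).
HB.instance Definition _ (R : realType) (h : R) :=
  gen_choiceMixin (holder_below h).

(* The open balls of all the norms form a subbase. A ball is indexed by its
   centre, the order of the norm and its radius. *)
Definition holder_balls (R : realType) (h : R) : set ((I01 R -> R) * R * R) :=
  [set i | [/\ holder_below_set h i.1.1, orders_below h i.1.2 & 0 < i.2]].

Definition holder_ball (R : realType) (h : R) (i : (I01 R -> R) * R * R) :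
    set (holder_below h) :=
  [set g : holder_below h |
    (holder_norm i.1.2 (fun t => g t - i.1.1 t)%R < i.2%:E)%E].

HB.instance Definition _ (R : realType) (h : R) :=
  isSubBaseTopological.Build (holder_below h)
    (@holder_balls R h) (@holder_ball R h).

Definition pointwise_holder (R : realType) (h : R) (t : I01 R) :
    set (I01 R -> R) :=
  [set f | (limf_esup
    (fun s : I01 R => (`|f s - f t| / `|val s - val t| `^ h)%:E) t^' < +oo)%E].

(* Main.v *)
Require Import Defs.
From mathcomp Require Import all_boot all_order all_algebra finmap.
From mathcomp Require Import all_classical all_reals all_analysis.
From mathcomp Require Import ring lra.

Import Order.TTheory GRing.Theory Num.Theory.
Import numFieldNormedType.Exports.
Local Open Scope classical_set_scope.
Local Open Scope ring_scope.

Set Implicit Arguments.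
Unset Strict Implicit.
Unset Printing Implicit Defensive.

(** Why almost every function of C^(<h) is nowhere C^h.

    If f is in C^h(t) with constant C, then f varies by at most 2 C N^-h between
    any two points of a cell [k/N, (k+1)/N] that contains t, once N is large.
    In particular, for some n and all N >= n, there is a cell k < N on which the
    increment of f from k/N to (k+1/2)/N is at most n N^-h. Call [slow_set n] the
    set of functions with this last property. It mentions t no more, so it is an
    intersection, over N, of finite unions, over k, of closed conditions on the
    values of f, and it is closed because evaluation is continuous
    ([closed_slow_set]). The sets [slow_set n] cover the exceptional set
    ([pointwise_holder_slow]).

    It remains to leave [slow_set n] by an arbitrarily small perturbation of a
    given f ([interior_slow_set]). Fix N large. In every cell where the increment
    of f is slow, add a bump of height (2n+1) N^-h that vanishes at the left end
    and peaks at the middle of the cell; leave the other cells alone. All N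
    increments now exceed n N^-h in absolute value, so the new function is not in
    [slow_set n]. The choice is made cell by cell, hence no cancellation can occur between f and the
    perturbation; this is why the argument also works for h > 1, where f may have
    critical points. A train of N bumps of height c, which are dilates by N of one
    fixed profile of class C^m with m > h, has a norm O(c N^a) in C^a
    ([bump_train_holder]). Here this is O(N^(a-h)), which tends to 0 for each
    a < h, and a neighbourhood of f involves only finitely many orders a.

    The profile is the polynomial bump (x (1 - x))_+^(m+1), whose
    derivatives up to order m are again of the form Q(x) (x (1 - x))_+^j with Q a
    polynomial ([poly_bump_chain]). *)

(** * Derivatives on the unit interval *)

Lemma I01_bounds (R : realType) (t : I01 R) : 0 <= val t <= 1.
Proof. exact: (set_mem (valP t)). Qed.

Definition I01_of (R : realType) (x : R) (x01 : 0 <= x <= 1) : I01 R :=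
  exist _ x (mem_set x01).

Lemma nbhs_I01 (R : realType) (t : I01 R) (A : set (I01 R)) :
  nbhs t A <-> exists2 e : R, 0 < e & forall s, `|val t - val s| < e -> A s.
Proof.
split.
  case=> _ [[U oU <-] Ut UA].
  have /nbhs_ballP[e /= e0 eU] : nbhs (val t) U by exact: open_nbhs_nbhs.
  by exists e => // s ts; apply: UA; exact: eU.
case=> e e0 eA; exists (val @^-1` (ball (val t) e)); split.
- by exists (ball (val t) e) => //; exact: ball_open.
- exact: ballxx.
- by move=> s; exact: eA.
Qed.

(** No point of [0, 1] is isolated, at the end points either; so limits of slopes
    are unique, which computing [D01] requires. *)
Lemma dnbhs_I01_proper (R : realType) (t : I01 R) : ProperFilter t^'.
Proof.
apply: Build_ProperFilter_ex => A /= /nbhs_I01[e e0 eA].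
have /andP[t0 t1] := I01_bounds t.
(* As d is at most 1/2, one of t + d and t - d stays in [0, 1]. *)
pose d := Num.min e 1 / 2.
have d0 : 0 < d by rewrite divr_gt0// lt_min e0 ltr01.
have de : d < e.
  by rewrite ltr_pdivrMr// gt_min; apply/orP; left; lra.
have d1 : d <= 2^-1 by rewrite ler_pdivrMr// ge_min mulVf// lexx orbT.
have [th|th] := leP (val t) 2^-1.
- have sI : 0 <= val t + d <= 1 by lra.
  exists (I01_of sI); apply: eA => /=.
    by rewrite opprD addNKr normrN gtr0_norm.
  by apply/eqP => /(congr1 val) /= ?; lra.
- have sI : 0 <= val t - d <= 1 by lra.
  exists (I01_of sI); apply: eA => /=.
    by rewrite opprB addrC subrK gtr0_norm.
  by apply/eqP => /(congr1 val) /= ?; lra.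
Qed.

(** A two-sided derivative on the line restricts to the interval, because the slopes
    at t are the usual difference quotients evaluated at s - t. *)
Lemma slope_cvg (R : realType) (P : R -> R) (dP : R) (t : I01 R) :
  is_derive (val t) 1 P dP ->
  slope (P \o val) t s @[s --> t^'] --> dP.
Proof.
case=> dPt; rewrite /derive => PE; move/cvg_ex: dPt => [l Pl].
have {PE}lE : l = dP by rewrite -PE; apply/esym/cvg_lim.
rewrite {}lE in Pl.
have sub0 : (val s - val t) @[s --> t^'] --> 0^'.
  move=> A /= /nbhs_ballP[e /= e0 eA]; apply/nbhs_I01; exists e => // s ts st.
  apply: eA; first by rewrite /ball/= sub0r normrN distrC.
  by rewrite subr_eq0; apply: contra st => /eqP /val_inj ->.
rewrite (_ : slope _ _ = (fun s => (val s - val t)^-1 *: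
   ((P \o shift (val t)) ((val s - val t) *: 1) - P (val t)))); last first.
  by apply/funext => s; rewrite /slope /= scaler1 subrK mulrC.
exact: (cvg_comp _ _ sub0 Pl).
Qed.

Lemma D01nS (R : realType) k (f : I01 R -> R) : D01n k.+1 f = D01 (D01n k f).
Proof. by []. Qed.

(** A function on the line is given here with its successive derivatives P 0, P 1,
    up to P m: this determines the iterated [D01], whose definition by limits gives
    no information by itself. *)
Lemma D01n_comp (R : realType) (P : nat -> R -> R) m :
  (forall i (x : R), (i < m)%N -> is_derive x 1 (P i) (P i.+1 x)) ->
  derivable01n m (P 0 \o val : I01 R -> R) /\
  forall k, (k <= m)%N -> D01n k (P 0 \o val : I01 R -> R) = P k \o val.
Proof.
move=> dP.
have DE : forall k, (k <= m)%N -> D01n k (P 0 \o val : I01 R -> R) = P k \o val.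
  elim => [//|k IH] km; rewrite D01nS (IH (ltnW km)).
  apply/funext => t; rewrite /D01; apply: cvg_lim.
  - exact: Rhausdorff.
  - exact: dnbhs_I01_proper.
  - exact/slope_cvg/dP.
split => // k km t; rewrite (DE _ (ltnW km)); apply/cvg_ex; exists (P k.+1 (val t)).
exact/slope_cvg/dP.
Qed.

(** Where a limit of slopes does not exist, [D01] has no reason to be additive; hence
    the formula also relies on the existence of the derivatives up to order m. *)
Lemma D01n_linear (R : realType) (f g : I01 R -> R) (c : R) m :
  derivable01n m f -> derivable01n m g ->
  derivable01n m (fun t => f t + c * g t) /\
  forall k, (k <= m)%N -> D01n k (fun t => f t + c * g t) =
     fun t => D01n k f t + c * D01n k g t.
Proof.
move=> df dg.
have slopeE (u v : I01 R -> R) t : slope (fun t => u t + c * v t) t =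
    slope u t + c \*: slope v t.
  by apply/funext => s; rewrite -[RHS]/(slope u t s + c * slope v t s) /slope; ring.
have DE : forall k, (k <= m)%N -> D01n k (fun t => f t + c * g t) =
     fun t => D01n k f t + c * D01n k g t.
  elim => [//|k IH] km; rewrite !D01nS (IH (ltnW km)).
  apply/funext => t; rewrite {1}/D01 slopeE; apply: cvg_lim.
  - exact: Rhausdorff.
  - exact: dnbhs_I01_proper.
  have FF := dnbhs_I01_proper t.
  by apply: cvgD; [exact: df | apply: cvgZl_tmp; exact: dg].
split => // k km t; rewrite (DE _ (ltnW km)) slopeE; apply: is_cvgD; first exact: df.
by apply: is_cvgZl_tmp; exact: dg.
Qed.

Lemma derivable01nB (R : realType) m (f g : I01 R -> R) :
  derivable01n m f -> derivable01n m g -> derivable01n m (fun t => f t - g t).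
Proof.
move=> df dg; have [+ _] := D01n_linear (-1) df dg.
by under [X in derivable01n _ X -> _]eq_fun do rewrite mulN1r.
Qed.

Lemma D01n_cst0 (R : realType) m : derivable01n m (fun _ : I01 R => 0 : R) /\
  forall k, (k <= m)%N -> D01n k (fun _ : I01 R => 0 : R) = fun=> 0.
Proof. by apply: (@D01n_comp R (fun=> fun=> 0) m) => i x _; exact: is_derive_cst. Qed.

(** * Hölder norms *)

Lemma unif_norm_ub (R : realType) (f : I01 R -> R) t :
  ((`|f t|)%:E <= unif_norm f)%E.
Proof. by apply: ereal_sup_ubound; exists t. Qed.

Lemma holder_seminorm_ub (R : realType) b (f : I01 R -> R) s t : s != t ->
  ((`|f s - f t| / `|val s - val t| `^ b)%:E <= holder_seminorm b f)%E.
Proof. by move=> st; apply: ereal_sup_ubound; exists (s, t). Qed.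

Lemma unif_normD (R : realType) (f g : I01 R -> R) :
  (unif_norm (fun t => f t + g t)%R <= unif_norm f + unif_norm g)%E.
Proof.
apply: ge_ereal_sup => _ [t _ <-].
apply: le_trans (leeD (unif_norm_ub f t) (unif_norm_ub g t)).
by rewrite -EFinD lee_fin ler_normD.
Qed.

Lemma holder_seminormD (R : realType) b (f g : I01 R -> R) :
  (holder_seminorm b (fun t => f t + g t)%R
     <= holder_seminorm b f + holder_seminorm b g)%E.
Proof.
apply: ge_ereal_sup => _ [[s t]/= st <-].
apply: le_trans (leeD (holder_seminorm_ub b f st) (holder_seminorm_ub b g st)).
rewrite -EFinD lee_fin -mulrDl ler_wpM2r ?invr_ge0 ?powR_ge0//.
by rewrite opprD addrACA ler_normD.
Qed.

Lemma holder_normD (R : realType) a (f g : I01 R -> R) :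
  derivable01n (Num.truncn a) f -> derivable01n (Num.truncn a) g ->
  (holder_norm a (fun t => f t + g t)%R <= holder_norm a f + holder_norm a g)%E.
Proof.
move=> df dg; have [_ DE] := D01n_linear 1 df dg.
have {}DE k : (k <= Num.truncn a)%N -> D01n k (fun t => f t + g t) =
    fun t => D01n k f t + D01n k g t.
  move=> /DE; under eq_fun do rewrite mul1r.
  by under [X in _ = X]eq_fun do rewrite mul1r.
rewrite /holder_norm addeACA -big_split/=; apply: leeD.
  rewrite !big_mkord; apply: lee_sum => k _.
  by rewrite DE ?unif_normD// -ltnS.
by rewrite DE ?holder_seminormD.
Qed.

Lemma holder_norm_le (R : realType) a (f : I01 R -> R) (B C : R) :
  (forall k t, (k <= Num.truncn a)%N -> `|D01n k f t| <= B) ->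
  (forall s t, `|D01n (Num.truncn a) f s - D01n (Num.truncn a) f t|
     <= C * `|val s - val t| `^ (a - (Num.truncn a)%:R)) ->
  (holder_norm a f <= ((Num.truncn a).+1%:R * B + C)%:E)%E.
Proof.
move=> fB fC; rewrite /holder_norm EFinD; apply: leeD.
  rewrite mulr_natl -[X in B *+ X]subn0 -sumr_const_nat -sumEFin !big_mkord.
  apply: lee_sum => k _; apply: ge_ereal_sup => _ [t _ <-].
  by rewrite lee_fin fB// -ltnS.
apply: ge_ereal_sup => _ [[s t]/= st <-].
rewrite lee_fin ler_pdivrMr// powR_gt0// normr_gt0 subr_eq0.
by apply: contra st => /eqP/val_inj ->.
Qed.

(** All terms of the norm must be nonnegative for the first one to be bounded by
    their sum; for the seminorm this needs two distinct points, since the supremum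
    of the empty set is -oo. *)
Lemma holder_norm_ub (R : realType) a (f : I01 R -> R) t :
  ((`|f t|)%:E <= holder_norm a f)%E.
Proof.
have h0 : 0 <= (0 : R) <= 1 by lra.
have h1 : 0 <= (1 : R) <= 1 by lra.
have ne : I01_of h0 != I01_of h1.
  by apply/eqP => /(congr1 val)/= /eqP; rewrite eq_sym oner_eq0.
rewrite /holder_norm big_nat_recl// -addeA -[leLHS]adde0.
apply: leeD; first exact: unif_norm_ub.
apply: adde_ge0.
  rewrite big_mkord; apply: sume_ge0 => k _.
  by apply: le_trans (unif_norm_ub _ t); rewrite lee_fin.
apply: le_trans (holder_seminorm_ub _ _ ne).
by rewrite lee_fin divr_ge0 ?powR_ge0.
Qed.

Lemma holder_norm_ge0 (R : realType) a (f : I01 R -> R) : (0 <= holder_norm a f)%E.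
Proof.
have h0 : 0 <= (0 : R) <= 1 by lra.
by apply: le_trans (holder_norm_ub a f (I01_of h0)); rewrite lee_fin.
Qed.

Lemma holder_norm0 (R : realType) a : (holder_norm a (fun _ : I01 R => 0%R) <= 0)%E.
Proof.
have [_ D0] := D01n_cst0 R (Num.truncn a).
have := @holder_norm_le R a (fun=> 0) 0 0; rewrite mulr0 addr0; apply.
  by move=> k t km; rewrite D0// normr0.
by move=> s t; rewrite D0// subrr normr0 mul0r.
Qed.

Lemma holder_below_setD (R : realType) (h : R) (f g : I01 R -> R) :
  holder_below_set h f ->
  (forall a, orders_below h a -> holder a g) ->
  holder_below_set h (fun t => f t + g t).
Proof.
move=> fh gh a ha; have [df nf] := fh a ha; have [dg ng] := gh a ha.
split.
  have [+ _] := D01n_linear 1 df dg.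
  by under [X in derivable01n _ X -> _]eq_fun do rewrite mul1r.
by apply: le_lt_trans (holder_normD df dg) _; exact: lte_add_pinfty.
Qed.

(** The bound on the upper limit is a bound on a punctured neighbourhood of t; at t
    itself it holds trivially. *)
Lemma pointwise_holder_near (R : realType) (h : R) (t : I01 R) f :
  pointwise_holder h t f ->
  exists2 C : R, 0 < C & exists2 e : R, 0 < e & forall s : I01 R,
    `|val t - val s| < e -> `|f s - f t| <= C * `|val s - val t| `^ h.
Proof.
rewrite /pointwise_holder/= limf_esupE => /ereal_inf_lt [_ [V /= tV <-] Vlt].
have /nbhs_I01[e e0 eV] := tV.
pose M := fine (ereal_sup [set (`|f s - f t| / `|val s - val t| `^ h)%:E | s in V]).
exists (Num.max M 1); first by rewrite lt_max ltr01 orbT.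
exists e => // s st; have [->|sNt] := eqVneq s t.
  by rewrite subrr normr0 mulr_ge0 ?powR_ge0// le_max ler01 orbT.
have p0 : 0 < `|val s - val t| `^ h.
  rewrite powR_gt0// normr_gt0 subr_eq0.
  by apply: contra sNt => /eqP/val_inj ->.
rewrite -ler_pdivrMr// le_max; apply/orP; left.
have le1 : ((`|f s - f t| / `|val s - val t| `^ h)%:E <=
  ereal_sup [set (`|f s - f t| / `|val s - val t| `^ h)%:E | s in V])%E.
  by apply: ereal_sup_ubound; exists s => //; exact: eV.
rewrite -lee_fin fineK// fin_numElt Vlt andbT.
exact: lt_le_trans (ltNyr _) le1.
Qed.

(** * The topology of the space *)

(** A neighbourhood constrains only finitely many norms. *)
Lemma nbhs_holder_below (R : realType) (h : R) (f : holder_below h)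
    (A : set (holder_below h)) :
  nbhs f A <-> exists2 D : {fset ((I01 R -> R) * R * R)},
    (forall i, i \in D -> holder_balls h i /\ holder_ball i f) &
    \bigcap_(i in [set` D]) @holder_ball R h i `<=` A.
Proof.
split.
  case=> B [[D' D'sub <-] [C D'C Cf] BA].
  have [D Dsub DC] := D'sub _ D'C.
  exists D.
    move=> i iD; split; first by have /set_mem := Dsub _ iD.
    by move: Cf; rewrite -DC; apply.
  by rewrite DC => g Cg; apply: BA; exists C.
case=> D Dsub DA.
exists (\bigcap_(i in [set` D]) @holder_ball R h i); split => //.
  exists [set \bigcap_(i in [set` D]) @holder_ball R h i].
    move=> _ ->; exists D => // i /Dsub [? _]; exact/mem_set.
  by rewrite bigcup_set1.
by move=> i /Dsub [].
Qed.

Lemma orders_below_half (R : realType) (h : R) : 0 < h ->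
  orders_below h (Num.min h 1 / 2).
Proof.
move=> h0; set a := Num.min h 1 / 2.
have m0 : 0 < Num.min h 1 by rewrite lt_min h0 ltr01.
have [mh m1] : Num.min h 1 <= h /\ Num.min h 1 <= 1.
  by rewrite !ge_min !lexx orbT.
have a0 : 0 < a < 1 by rewrite /a; lra.
split; first by rewrite /a; lra.
apply/negP => /intrP[z az]; move: a0; rewrite az ltr0z ltrz1 gtz0_ge1 ltNge.
by move=> /andP[->].
Qed.

Lemma holder_ball_nbhs (R : realType) (h : R) (f : holder_below h) (a r : R) :
  orders_below h a -> 0 < r -> nbhs f (@holder_ball R h (f : I01 R -> R, a, r)).
Proof.
move=> ha r0; apply/nbhs_holder_below.
exists [fset (f : I01 R -> R, a, r)]%fset.
  move=> i /fset1P ->; split.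
    by split => //=; exact: holder_belowP.
  rewrite /holder_ball/=; under eq_fun do rewrite subrr.
  by rewrite (le_lt_trans (holder_norm0 a))// lte_fin.
by move=> g /(_ (f : I01 R -> R, a, r)); apply; rewrite /= fset11.
Qed.

(** Every Hölder norm dominates the uniform norm, so one of them is enough. *)
Lemma holder_below_eval_continuous (R : realType) (h : R) (x : I01 R) :
  0 < h -> continuous (fun f : holder_below h => f x : R).
Proof.
move=> h0 f; apply/(@cvgrPdist_lt _ _ _ _ (nbhs_filter f)) => e e0.
apply: (@filterS _ (nbhs f) (nbhs_filter f) _ _ _
  (holder_ball_nbhs f (orders_below_half h0) e0)) => g /= fg.
rewrite distrC -lte_fin; apply: le_lt_trans fg.
exact: (holder_norm_ub _ (fun t => g t - f t)).
Qed.

Lemma closed_increment_le (R : realType) (h : R) (x y : I01 R) (c : R) : 0 < h ->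
  closed [set f : holder_below h | `|f x - f y| <= c].
Proof.
move=> h0; apply: (@preimage_closed _ _
  (fun f : holder_below h => `|f x - f y| : R) [set u | u <= c]); last first.
  exact: closed_le.
have FF (f : holder_below h) : Filter (nbhs f) := nbhs_filter f.
by move=> f _; apply: (@cvg_norm _ _ _ _ (FF f)); apply: (@cvgB _ _ _ _ (FF f));
  exact: holder_below_eval_continuous.
Qed.

(** * Polynomial bumps *)

Lemma is_derive_quadratic (R : realType) (f : R -> R) (x d : R) :
  (forall k, `|f (k + x) - f x - d * k| <= k ^+ 2) -> is_derive x 1 f d.
Proof.
move=> fq.
have cv : h^-1 *: ((f \o shift x) (h *: 1) - f x) @[h --> 0^'] --> d.
  apply/cvgrPdist_lt => e e0; near=> k.
  have k0 : k != 0 by near: k; exact: nbhs_dnbhs_neq.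
  have ke : `|k| < e by near: k; apply: dnbhs0_lt.
  apply: le_lt_trans ke; rewrite /= [k *: 1]mulr1 [_ *: _]mulrC.
  rewrite -(ler_pM2r (_ : 0 < `|k|)) ?normr_gt0// -normrM mulrBl divfK//.
  by rewrite distrC -normrM -expr2 [leRHS]ger0_norm ?sqr_ge0.
split; first by apply/cvg_ex; exists d.
exact: cvg_lim cv.
Unshelve. all: by end_near. Qed.

Lemma pos_part_exprS (R : realDomainType) (y : R) i :
  Num.max 0 y ^+ i.+2 = y * Num.max 0 y ^+ i.+1.
Proof. by case: (leP 0 y) => _; rewrite ?exprS// !mul0r mulr0. Qed.

(** The square of the positive part differs from its tangent by at most k^2, which
    treats the point 0 like any other. Higher powers follow by the product rule, as
    multiplying a positive power of the positive part by y raises the exponent. *)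
Lemma is_derive_pos_part_exp (R : realType) n (x : R) :
  is_derive x 1 (fun y => Num.max 0 y ^+ n.+2) (n.+2%:R * Num.max 0 x ^+ n.+1).
Proof.
elim: n x => [|n IH] x.
  apply: is_derive_quadratic => k; rewrite ler_norml.
  by case: (leP 0 (k + x)); case: (leP 0 x) => ? ?; nra.
rewrite (_ : (fun _ => _) = id * (fun y => Num.max 0 y ^+ n.+2)); last first.
  by apply/funext => y; rewrite pos_part_exprS.
apply: (is_derive_eq (is_deriveM (is_derive_id x 1) (IH x))).
rewrite -[LHS]/(x * (n.+2%:R * Num.max 0 x ^+ n.+1) + Num.max 0 x ^+ n.+2 * 1).
by rewrite mulrCA -pos_part_exprS mulr1 -(natr1 n.+2) [RHS]mulrDl mul1r.
Qed.

Lemma poly_unit_itv_bounded (R : realType) (Q : {poly R}) :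
  exists2 B : R, 0 <= B & forall x, 0 < x < 1 -> `|Q.[x]| <= B.
Proof.
exists (\sum_(i < size Q) `|Q`_i|); first exact: sumr_ge0.
move=> x x01; rewrite horner_coef; apply: le_trans (ler_norm_sum _ _ _) _.
apply: ler_sum => i _; rewrite normrM ler_piMr// normrX exprn_ile1//.
by rewrite ler_norml; lra.
Qed.

(** The positive part makes the bump vanish outside ]0, 1[, and the exponent n
    makes it of class C^(n-1). The factor Q gives a family closed under
    differentiation. *)
Definition poly_bump (R : realType) (Q : {poly R}) n (x : R) : R :=
  Q.[x] * Num.max 0 (x * (1 - x)) ^+ n.

Lemma poly_bump_out (R : realType) (Q : {poly R}) n x :
  ~~ (0 < x < 1) -> poly_bump Q n.+1 x = 0.
Proof.
move=> x01; rewrite /poly_bump max_l ?expr0n ?mulr0//.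
by move: x01; rewrite negb_and -!leNgt => /orP[]?; nra.
Qed.

Lemma poly_bump_bounded (R : realType) (Q : {poly R}) n :
  exists2 B : R, 0 <= B & forall x, `|poly_bump Q n.+1 x| <= B.
Proof.
have [B B0 QB] := poly_unit_itv_bounded Q; exists B => // x.
have [x01|/(poly_bump_out Q n)->] := boolP (0 < x < 1); last by rewrite normr0.
rewrite normrM (le_trans _ (QB _ x01))// ler_piMr// normrX exprn_ile1//.
by rewrite max_r ?ler_norml; nra.
Qed.

(** With u = x (1 - x): (Q u_+^(n+2))' = (Q' u + (n+2) Q u') u_+^(n+1). *)
Lemma is_derive_poly_bump (R : realType) (Q : {poly R}) n (x : R) :
  is_derive x 1 (poly_bump Q n.+2)
    (poly_bump (Q^`() * ('X - 'X^2) + n.+2%:R *: (Q * (1 - 2%:R *: 'X))) n.+1 x).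
Proof.
have uE (y : R) : ('X - 'X^2).[y] = y * (1 - y) by rewrite !hornerE; ring.
have -> : poly_bump Q n.+2 = horner Q *
    ((fun y => Num.max 0 y ^+ n.+2) \o horner ('X - 'X^2)).
  by apply/funext => y; rewrite /poly_bump -uE.
have d1 := is_derive_pos_part_exp n ('X - 'X^2).[x].
have d2 := is_derive1_comp d1 (is_derive_poly ('X - 'X^2) x).
apply: (is_derive_eq (is_deriveM (is_derive_poly Q x) d2)).
rewrite /poly_bump /= uE.
rewrite !(derivB, derivX, derivXn, hornerE).
set u := x * (1 - x).
rewrite pos_part_exprS /GRing.scale/= /u; ring.
Qed.

(** The bound B is common to all the derivatives that are used. The exponent drops by
    one at each differentiation and is still 1 for the last one, P m, which is
    therefore continuous and vanishes at 0 and 1 but need not be differentiable. *)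
Lemma poly_bump_chain (R : realType) m (Q : {poly R}) :
  exists P : nat -> R -> R, [/\ P 0 = poly_bump Q m.+1,
    (forall i (x : R), (i < m)%N -> is_derive x 1 (P i) (P i.+1 x)),
    (forall i x, (i <= m)%N -> ~~ (0 < x < 1) -> P i x = 0) &
    exists2 B : R, 0 <= B & forall i x, (i <= m)%N -> `|P i x| <= B].
Proof.
elim: m Q => [|m IH] Q.
  exists (fun=> poly_bump Q 1); split => //; first by move=> i x _ /poly_bump_out.
  by have [B B0 QB] := poly_bump_bounded Q 0; exists B.
have [P [P0 dP Pout [B B0 PB]]] :=
  IH (Q^`() * ('X - 'X^2) + m.+2%:R *: (Q * (1 - 2%:R *: 'X))).
have [B' B'0 QB] := poly_bump_bounded Q m.+1.
exists (fun i => if i is j.+1 then P j else poly_bump Q m.+2); split => //.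
- move=> [|i] x im; last exact: dP.
  by rewrite P0; exact: is_derive_poly_bump.
- by move=> [|i] x im; [exact: poly_bump_out | exact: Pout].
- exists (Num.max B B'); first by rewrite le_max B0.
  by move=> [|i] x im; rewrite le_max ?QB ?orbT// PB.
Qed.

(** The translates have disjoint supports; y = k0 is allowed since the bump at k0 and
    all the others vanish there. *)
Lemma bump_sumE (R : realType) (P : R -> R) n (eta : nat -> R) (y : R) k0 :
  (forall x, ~~ (0 < x < 1) -> P x = 0) -> (k0 < n)%N -> 0 <= y - k0%:R < 1 ->
  \sum_(k < n) eta k * P (y - k%:R) = eta k0 * P (y - k0%:R).
Proof.
move=> Pout k0n yk0; rewrite (bigD1 (Ordinal k0n))//= big1 ?addr0// => k kk0.
rewrite Pout ?mulr0//; apply: contra kk0 => yk; apply/eqP/val_inj => /=.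
have h1 : (k%:R : R) < k0.+1%:R by rewrite -natr1; lra.
have h2 : (k0%:R : R) < k.+1%:R by rewrite -natr1; lra.
by apply/eqP; rewrite eqn_leq; move: h1 h2; rewrite !ltr_nat !ltnS => -> ->.
Qed.

Lemma bump_sum_le (R : realType) (P : R -> R) n (eta : nat -> R) (y B c : R) :
  (forall x, ~~ (0 < x < 1) -> P x = 0) -> (forall x, `|P x| <= B) ->
  (forall k, `|eta k| <= c) ->
  `|\sum_(k < n) eta k * P (y - k%:R)| <= c * B.
Proof.
move=> Pout PB ec.
case: (pickP (fun k : 'I_n => 0 < y - k%:R < 1)) => [k0 /andP[y0 y1]|none].
  have y01 : 0 <= y - k0%:R < 1 by rewrite y1 ltW.
  by rewrite (bump_sumE _ Pout (ltn_ord k0) y01) normrM ler_pM.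
rewrite big1 ?normr0; last by move=> k _; rewrite Pout ?mulr0 ?none.
by rewrite mulr_ge0 ?(le_trans _ (PB 0))// (le_trans _ (ec 0)).
Qed.

(** The bump in cell k, of length 1/(N+1), has height eta k at the middle of the cell.
    Each differentiation costs a factor N+1, and, as the supports are disjoint, the
    number of bumps does not enter the bounds. *)
Lemma bump_train (R : realType) m :
  exists2 K : R, 0 <= K & forall N (eta : nat -> R) (c : R),
    (forall k, `|eta k| <= c) ->
    exists S : nat -> R -> R, [/\
      forall i (x : R), (i < m)%N -> is_derive x 1 (S i) (S i.+1 x),
      forall i x, (i <= m)%N -> `|S i x| <= c * K * N.+1%:R ^+ i,
      forall k, (k < N.+1)%N -> S 0 (k%:R / N.+1%:R) = 0 &
      forall k, (k < N.+1)%N -> S 0 ((k%:R + 2^-1) / N.+1%:R) = eta k].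
Proof.
(* The maximum of x (1 - x) is 1/4, so this factor normalises the peak to 1. *)
have [P [P0 dP Pout [B B0 PB]]] := @poly_bump_chain R m (4 ^+ m.+1)%:P.
have Ph : P 0 2^-1 = 1.
  rewrite P0 /poly_bump hornerC (_ : 2^-1 * _ = 4^-1); last by field.
  by rewrite max_r// exprVn divff// expf_neq0.
exists B => // N eta c ec.
pose S i x := N.+1%:R ^+ i * \sum_(k < N.+1) eta k * P i (N.+1%:R * x - k%:R).
have S0 k y : (k < N.+1)%N -> 0 <= y < 1 ->
    S 0 ((k%:R + y) / N.+1%:R) = eta k * P 0 y.
  move=> kN y01; rewrite /S expr0 mul1r mulrC divfK//.
  have Pout0 x : ~~ (0 < x < 1) -> P 0 x = 0 by exact: Pout.
  have e : k%:R + y - k%:R = y by ring.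
  by rewrite (bump_sumE _ Pout0 kN) e.
exists S; split.
- move=> i x im; rewrite {1}/S.
  have -> : (fun x => N.+1%:R ^+ i * \sum_(k < N.+1) eta k * P i (N.+1%:R * x - k%:R)) =
     N.+1%:R ^+ i \*: \sum_(k < N.+1) (eta k \*:
        (P i \o horner (N.+1%:R *: 'X - (k%:R)%:P))).
    apply/funext => z; rewrite -[RHS]/(_ * _) fct_sumE; congr (_ * _).
    by apply: eq_bigr => k _; rewrite -[RHS]/(_ * _) /= !hornerE.
  apply: (is_derive_eq (is_deriveZ _ (is_derive_sum (fun k =>
    is_deriveZ _ (is_derive1_comp (dP _ _ im) (is_derive_poly _ _)))))).
  rewrite /S exprSr -mulrA mulr_sumr -[LHS]/(_ * _); congr (_ * _).
  apply: eq_bigr => k _; rewrite -[LHS]/(_ * _).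
  rewrite !(derivB, derivZ, derivX, derivC, hornerE) /=.
  by rewrite -[LHS]/(_ * _); ring.
- move=> i x im; rewrite /S normrM [leRHS]mulrC ger0_norm ?exprn_ge0//.
  rewrite ler_wpM2l ?exprn_ge0//; apply: bump_sum_le => // y; first exact: Pout.
  exact: PB.
- move=> k kN; rewrite -[k%:R]addr0 S0//; last by rewrite lexx ltr01.
  by rewrite Pout ?mulr0// ltxx.
- move=> k kN; rewrite S0//; first by rewrite Ph mulr1.
  by rewrite invr_ge0 ler0n invf_lt1// ltr1n.
Qed.

(** * Hölder norms of trains of bumps *)

Lemma derive_bound_increment (R : realType) (f df : R -> R) (L : R) :
  (forall x : R, is_derive x 1 f (df x)) -> (forall x, `|df x| <= L) ->
  forall x y, `|f x - f y| <= L * `|x - y|.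
Proof.
move=> fdf dfL x y; wlog xy : x y / x <= y.
  by move=> W; case: (leP x y) => [/W//|/ltW/W]; rewrite distrC [X in _ * X]distrC.
have cf : {within `[x, y], continuous f}.
  by apply: derivable_within_continuous => z _; case: (fdf z).
have [z _ fE] := MVT_segment xy (fun z _ => fdf z) cf.
by rewrite distrC fE normrM [X in _ * X <= _]distrC ler_wpM2r.
Qed.

(** If |x - y| <= 1/N the derivative gives A N |x - y|, otherwise the uniform bound
    gives 2 A; both are at most 2 A (N |x - y|)^b, since N |x - y| is on the
    corresponding side of 1 and b is in [0, 1]. *)
Lemma holder_interpolation (R : realType) (f df : R -> R) (A N b : R) :
  0 < N -> 0 <= b <= 1 ->
  (forall x : R, is_derive x 1 f (df x)) -> (forall x, `|f x| <= A) ->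
  (forall x, `|df x| <= A * N) ->
  forall x y, `|f x - f y| <= 2 * A * N `^ b * `|x - y| `^ b.
Proof.
move=> N0 /andP[b0 b1] fdf fA dfA x y.
have A0 : 0 <= A by apply: le_trans (fA 0).
have [->|xy] := eqVneq x y.
  by rewrite !subrr normr0 !mulr_ge0 ?powR_ge0.
have xy0 : 0 < `|x - y| by rewrite normr_gt0 subr_eq0.
rewrite -mulrA -powRM ?(ltW N0)//.
have [le1|gt1] := leP (N * `|x - y|) 1.
  apply: (le_trans (derive_bound_increment fdf dfA x y)).
  have le2 : N * `|x - y| <= (N * `|x - y|) `^ b.
    by apply: ger1_powR => //; rewrite mulr_gt0.
  rewrite -mulrA; apply: (le_trans (ler_wpM2l A0 le2)).
  by rewrite ler_wpM2r ?powR_ge0//; lra.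
have le2 : 1 <= (N * `|x - y|) `^ b.
  have -> : 1 = 1 `^ b :> R by rewrite powR1.
  by rewrite ge0_ler_powR ?nnegrE ?ler01// ltW// (lt_trans ltr01).
apply: (le_trans (ler_normB _ _)).
apply: (@le_trans _ _ (2 * A)); last by rewrite ler_peMr// mulr_ge0.
by rewrite mulr_natl mulr2n lerD.
Qed.

(** The derivatives of order i <= a of the train are O(c N^i), hence O(c N^a), and the
    seminorm interpolates between the orders of the integer part of a and the next
    one; this is why the latter is required to be at most m. *)
Lemma bump_train_holder (R : realType) m :
  exists2 K : R, 0 <= K & forall N (eta : nat -> R) (c : R),
    (forall k, `|eta k| <= c) ->
    exists S : I01 R -> R, [/\
      forall a, 0 <= a -> (Num.truncn a < m)%N ->
        derivable01n (Num.truncn a) S /\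
        (holder_norm a S <=
          ((Num.truncn a + 3)%:R * (c * K) * N.+1%:R `^ a)%:E)%E,
      forall k (x : I01 R), (k < N.+1)%N -> val x = k%:R / N.+1%:R -> S x = 0 &
      forall k (x : I01 R), (k < N.+1)%N -> val x = (k%:R + 2^-1) / N.+1%:R ->
        S x = eta k].
Proof.
have [K K0 KS] := bump_train R m; exists K => // N eta c ec.
have [S [dS bS S0 S1]] := KS N eta c ec.
have cK0 : 0 <= c * K by rewrite mulr_ge0// (le_trans _ (ec 0)).
exists (S 0 \o val); split; last 2 first.
- by move=> k x kN /= ->; exact: S0.
- by move=> k x kN /= ->; exact: S1.
move=> a a0 am; set t := Num.truncn a in am *.
have ta : t%:R <= a by rewrite truncn_le.
have at1 : a < t.+1%:R by rewrite -truncn_lt_nat.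
have N1 : 1 <= N.+1%:R :> R by rewrite ler1n.
have dSt i (x : R) : (i < t)%N -> is_derive x 1 (S i) (S i.+1 x).
  by move=> it; apply: dS; exact: ltn_trans it am.
have [derS DE] := D01n_comp dSt; split => //.
have -> : (t + 3)%:R * (c * K) * N.+1%:R `^ a =
    t.+1%:R * (c * K * N.+1%:R `^ a) + 2 * (c * K) * N.+1%:R `^ a.
  by rewrite natrD -(natr1 t); ring.
apply: holder_norm_le => [k s kt|s u].
  rewrite DE//; apply: (le_trans (bS k _ (ltnW (leq_ltn_trans kt am)))).
  rewrite ler_wpM2l// -powR_mulrn ?(le_trans ler01)// ler_powR//.
  by rewrite (le_trans _ ta)// ler_nat.
rewrite DE// -/t.
have dF (x : R) : is_derive x 1 (S t) (S t.+1 x) by exact: dS.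
have bF x : `|S t x| <= c * K * N.+1%:R ^+ t by apply: bS; exact: ltnW.
have bdF x : `|S t.+1 x| <= c * K * N.+1%:R ^+ t * N.+1%:R.
  by rewrite -mulrA -exprSr; exact: bS.
have b01 : 0 <= a - t%:R <= 1.
  by rewrite subr_ge0 ta lerBlDl natr1 ltW.
apply: (le_trans (holder_interpolation _ b01 dF bF bdF _ _)) => //.
rewrite ler_wpM2r ?powR_ge0// -!mulrA -powR_mulrn ?(le_trans ler01)//.
rewrite -powRD; last by rewrite pnatr_eq0 implybT.
by rewrite addrC subrK.
Qed.

Lemma powR_nat_small (R : realType) (C e s : R) : 0 < e -> 0 < s -> 0 <= C ->
  \forall N \near \oo, C * N.+1%:R `^ (- s) < e.
Proof.
move=> e0 s0 C0; near=> N.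
have N0 : 0 < N.+1%:R `^ s by rewrite powR_gt0.
rewrite powRN ltr_pdivrMr// -ltr_pdivrMl// mulrC.
have X0 : 0 <= C / e by rewrite divr_ge0// ltW.
have {1}-> : C / e = ((C / e) `^ s^-1) `^ s.
  by rewrite -powRrM mulVf ?gt_eqF// powRr1.
rewrite gt0_ltr_powR// ?nnegrE ?powR_ge0// (@lt_trans _ _ N%:R) ?ltr_nat//.
by near: N; exact: nbhs_infty_gtr.
Unshelve. all: by end_near. Qed.

(** * The Baire category argument *)

(** The pair of the left end and the middle of the cell k among N+1, described by its
    values so that no proof that they lie in [0, 1] is carried around. *)
Definition half_cell (R : realType) (N k : nat) : set (I01 R * I01 R) :=
  [set p | val p.1 = k%:R / N.+1%:R /\ val p.2 = (k%:R + 2^-1) / N.+1%:R].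

(** The subdivisions have N+1 cells, which rules out the empty one. *)
Definition slow_set (R : realType) (h : R) (n : nat) : set (holder_below h) :=
  \bigcap_(N in [set N | (n <= N)%N]) \bigcup_(k in `I_N.+1)
    \bigcap_(p in half_cell N k)
      [set f : holder_below h | `|f p.2 - f p.1| <= n%:R * N.+1%:R `^ (- h)].

Lemma closed_slow_set (R : realType) (h : R) n : 0 < h -> closed (@slow_set R h n).
Proof.
move=> h0; apply: closed_bigI => N _; apply: closed_bigcup => // k _.
by apply: closed_bigI => p _; exact: closed_increment_le.
Qed.

Lemma half_cell_ex (R : realType) (N k : nat) : (k < N.+1)%N ->
  exists p, @half_cell R N k p.
Proof.
move=> kN; have kN' : k.+1%:R <= N.+1%:R :> R by rewrite ler_nat.
have N0 : 0 < N.+1%:R :> R by rewrite ltr0n.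
have k0 : 0 <= k%:R :> R by rewrite ler0n.
rewrite -natr1 in kN'.
have u01 : 0 <= (k%:R / N.+1%:R : R) <= 1.
  by rewrite divr_ge0 ?(ltW N0)//= ler_pdivrMr//; lra.
have v01 : 0 <= ((k%:R + 2^-1) / N.+1%:R : R) <= 1.
  by rewrite ler_pdivrMr// divr_ge0 ?(ltW N0)//=; lra.
by exists (I01_of u01, I01_of v01).
Qed.

(** Both points of the cell that contains t are close to t, so the increment between
    them is at most twice the Hölder bound at t. *)
Lemma pointwise_holder_slow (R : realType) (h : R) (f : holder_below h) t :
  0 < h -> pointwise_holder h t f -> (\bigcup_n @slow_set R h n) f.
Proof.
move=> h0 /pointwise_holder_near[C C0 [e e0 fC]].
have [n1 n1C] : exists n : nat, 2 * C < n%:R.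
  by exists (Num.truncn (2 * C)).+1; rewrite truncnS_gt.
have [n2 n2e] : exists n : nat, e^-1 < n%:R.
  by exists (Num.truncn e^-1).+1; rewrite truncnS_gt.
(* n1 absorbs the constant 2 C, and n2 makes the cells shorter than e. *)
exists (maxn n1 n2) => // N; rewrite /= geq_max => /andP[n1N n2N].
have /andP[t0 t1] := I01_bounds t.
have N0 : 0 < N.+1%:R :> R by rewrite ltr0n.
have Ne : N.+1%:R^-1 < e.
  rewrite -[ltRHS]invrK ltf_pV2 ?posrE ?invr_gt0// (lt_le_trans n2e)//.
  by rewrite ler_nat; apply: leq_trans n2N _.
pose x := val t * N.+1%:R.
have x0 : 0 <= x by rewrite mulr_ge0.
have xN : x <= N.+1%:R by rewrite ler_piMl.
(* The cell that contains t is given by the integer part of x, except that t = 1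
   belongs to the last cell. *)
have [k kN /andP[kx xk]] : exists2 k, (k < N.+1)%N & k%:R <= x <= k.+1%:R.
  have /andP[tx xt] := truncn_itv x0.
  have [tN|Nt] := ltnP (Num.truncn x) N.+1.
    by exists (Num.truncn x) => //; rewrite tx ltW.
  exists N => //; rewrite xN andbT (le_trans _ tx)// ler_nat ltnW//.
rewrite -natr1 in xk.
have close (s : I01 R) : k%:R <= val s * N.+1%:R <= k%:R + 1 ->
    `|f s - f t| <= C * N.+1%:R `^ (- h).
  move=> sk; have ts : `|val t - val s| <= N.+1%:R^-1.
    rewrite -[leRHS]mul1r ler_pdivlMr// -[X in _ * X]gtr0_norm// -normrM.
    by rewrite mulrBl ler_norml -/x; lra.
  apply: le_trans (fC s (le_lt_trans ts Ne)) _.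
  rewrite ler_pM2l// -[- h]mulN1r powRrM powR_inv1 ?(ltW N0)// distrC.
  by rewrite ge0_ler_powR ?nnegrE ?invr_ge0// ltW.
exists k => // -[u v] /= [uE vE].
have fu := close u; have fv := close v.
rewrite uE divfK ?gt_eqF// in fu; rewrite vE divfK ?gt_eqF// in fv.
have {}fu := fu ltac:(lra); have {}fv := fv ltac:(lra).
rewrite (_ : f v - f u = (f v - f t) - (f u - f t)); last by ring.
apply: le_trans (ler_normB _ _) _; apply: le_trans (lerD fv fu) _.
rewrite -mulrDl ler_wpM2r ?powR_ge0//.
have : n1%:R <= (maxn n1 n2)%:R :> R by rewrite ler_nat leq_maxl.
lra.
Qed.

(** In a given neighbourhood of f, adding to f a fine enough train of bumps, with a bump
    exactly in those cells where f is slow, leads out of the slow set. *)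
Lemma interior_slow_set (R : realType) (h : R) n : 0 < h ->
  interior (@slow_set R h n) = set0.
Proof.
move=> h0; rewrite -subset0 => f /= /nbhs_holder_below [D fD Dslow].
pose m := (Num.truncn h).+1.
have [K K0 KS] := bump_train_holder R m.
(* A slow increment is at most n N^-h in absolute value; adding 2n+1 times N^-h brings
   it to at least (n+1) N^-h. *)
pose L := n.*2.+1%:R : R.
pose c N := L * N.+1%:R `^ (- h) : R.
have L0 : 0 <= L by rewrite ler0n.
have order_lt a : orders_below h a -> 0 <= a /\ (Num.truncn a < m)%N.
  by case=> /andP[a0 ah] _; split; [exact: ltW | rewrite ltnS le_truncn// ltW].
(* A single N is large enough for the finitely many balls that contain f. *)
have [N [nN ND]] : exists N, (n <= N)%N /\ forall i, i \in D ->
    (holder_norm i.1.2 (fun t => f t - i.1.1 t)%R +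
     ((Num.truncn i.1.2 + 3)%:R * (c N * K) * N.+1%:R `^ i.1.2)%:E < i.2%:E)%E.
  have : \forall N \near \oo, (n <= N)%N /\ forall i, i \in D ->
    (holder_norm i.1.2 (fun t => f t - i.1.1 t)%R +
     ((Num.truncn i.1.2 + 3)%:R * (c N * K) * N.+1%:R `^ i.1.2)%:E < i.2%:E)%E.
    near=> N; split; first by near: N; exact: nbhs_infty_ge.
    move=> i iD; move: i iD; near: N.
    apply: (@filter_bigI _ _ D (fun i => [set N : nat | _]) \oo) => i iD.
    have [[hc ha r0] fi] := fD i iD.
    have fn : holder_norm i.1.2 (fun t => f t - i.1.1 t) \is a fin_num.
      rewrite ge0_fin_numE ?holder_norm_ge0//; exact: lt_trans fi (ltry _).
    rewrite /holder_ball/= -(fineK fn) lte_fin in fi.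
    have [/andP[a0 ah] _] := ha.
    have := @powR_nat_small R ((Num.truncn i.1.2 + 3)%:R * (L * K))
      (i.2 - fine (holder_norm i.1.2 (fun t => f t - i.1.1 t)))
      (h - i.1.2).
    rewrite !subr_gt0 => /(_ fi ah) /(_ _)[|N0 _ N0P]; first by rewrite !mulr_ge0.
    exists N0 => // N /N0P /=.
    rewrite -(fineK fn) -EFinD lte_fin ltrBrDl; congr (_ + _ < _).
    rewrite opprB addrC powRD; last by rewrite pnatr_eq0 implybT.
    by rewrite /c; ring.
  by case=> N0 _ /(_ N0 (leqnn _)) ?; exists N0.
have c0 : 0 <= c N by rewrite mulr_ge0 ?powR_ge0.
pose slow k := forall p, @half_cell R N k p ->
  `|f p.2 - f p.1| <= n%:R * N.+1%:R `^ (- h).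
pose eta k := if `[< slow k >] then c N else 0.
have etac k : `|eta k| <= c N.
  by rewrite /eta; case: ifP; rewrite ?normr0// ger0_norm.
have [S [SH S0 S1]] := KS N eta (c N) etac.
have SHh a : orders_below h a -> holder a S.
  move=> /order_lt[a0 am]; have [dS nS] := SH a a0 am; split => //.
  exact: le_lt_trans nS (ltry _).
pose g := HolderBelow (holder_below_setD (holder_belowP f) SHh).
have : slow_set n g.
  apply: Dslow => i /= iD; have [[hc ha r0] fi] := fD i iD.
  have [a0 am] := order_lt _ ha; have [dS nS] := SH _ a0 am.
  apply: le_lt_trans (ND i iD).
  apply: le_trans (leeD2l _ nS).
  rewrite [X in (holder_norm _ X <= _)%E](_ : _ =
    (fun t => (f t - i.1.1 t) + S t)); last first.
    by apply/funext => t; rewrite /= addrAC.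
  apply: holder_normD dS; apply: derivable01nB; last by have [] := hc _ ha.
  by have [] := holder_belowP f ha.
move=> /(_ N nN) [k /= kN gk].
have [p pk] := half_cell_ex R kN.
have pN0 : 0 < N.+1%:R `^ (- h) :> R by rewrite powR_gt0.
have gE q : half_cell N k q -> g q.2 - g q.1 = f q.2 - f q.1 + eta k.
  by case=> q1 q2; rewrite /= (S0 _ _ kN q1) (S1 _ _ kN q2); ring.
have {}gk q : half_cell N k q ->
    `|f q.2 - f q.1 + eta k| <= n%:R * N.+1%:R `^ (- h).
  by move=> qk; rewrite -(gE q qk); exact: gk q qk.
have [sk|nsk] := pselect (slow k); last first.
  have e0 : eta k = 0 by rewrite /eta asboolF.
  by apply: nsk => q /gk; rewrite e0 addr0.
have ek : eta k = c N by rewrite /eta asboolT.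
have := gk p pk; have := sk p pk; rewrite ek /c /L -muln2 -(natr1 (n * 2)) natrM.
set w := _ `^ _ in pN0 *; set d := _ - _.
by rewrite !ler_norml => /andP[? ?] /andP[? ?]; nra.
Unshelve. all: by end_near. Qed.

Theorem proposition6p4 (R : realType) (h : R) (h_gt0 : 0 < h) :
  baire_residual
    [set f : holder_below h | forall t : I01 R, ~ pointwise_holder h t f].
Proof.
exists (@slow_set R h); split.
  by move=> n; split; [exact: closed_slow_set | exact: interior_slow_set].
move=> f /= /existsNP[t /contrapT ft]; exact: pointwise_holder_slow ft.
Qed.
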